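(* Let $\mathcal{R}$ be a finite simple Lie conformal algebra. Then $CTDer(\mathcal{R})=CDer(\mathcal{R})$, i.e. every conformal triple derivation of $\mathcal{R}$ is a conformal derivation and conversely.
   Context: All vector spaces are over $\mathbb{C}$. A Lie conformal algebra is a $\mathbb{C}[\partial]$-module $\mathcal{R}$ with a $\mathbb{C}$-linear map $\mathcal{R}\otimes\mathcal{R}\to\mathbb{C}[\lambda]\otimes\mathcal{R}$, $a\otimes b\mapsto[a_\lambda b]$, satisfying $[\partial a_\lambda b]=-\lambda[a_\lambda b]$, $[a_\lambda\partial b]=(\partial+\lambda)[a_\lambda b]$, $[a_\lambda b]=-[b_{-\lambda-\partial}a]$, and $[a_\lambda[b_\mu c]]=[[a_\lambda b]_{\lambda+\mu}c]+[b_\mu[a_\lambda c]]$. It is finite if it is finitely generated as a $\mathbb{C}[\partial]$-module; it is simple if it has no non-trivial ideals and is not abelian (i.e. its $\lambda$-bracket is not identically zero). A conformal linear map on $\mathcal{R}$ is a $\mathbb{C}$-linear map $\phi_x:\mathcal{R}\to\mathbb{C}[x]\otimes\mathcal{R}$ with $\phi_x(\partial a)=(\partial+x)\phi_x(a)$; the name of the indeterminate is immaterial. The set of these is denoted $gc(\mathcal{R})$. $\phi\in gc(\mathcal{R})$ is a conformal derivation if $\phi_x([a_\mu b])=[\phi_x(a)_{\mu+x}b]+[a_\mu\phi_x(b)]$ for all $a,b\in\mathcal{R}$; the set of these is $CDer(\mathcal{R})$. $\phi\in gc(\mathcal{R})$ is a conformal triple derivation if for all $a,b,c\in\mathcal{R}$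 $$\phi_x([[a_\lambda b]_{\lambda+\mu}c])=[[\phi_x(a)_{\lambda+x}b]_{\lambda+\mu+x}c]+[[a_\lambda\phi_x(b)]_{\lambda+\mu+x}c]+[[a_\lambda b]_{\lambda+\mu}\phi_x(c)];$$ the set of these is $CTDer(\mathcal{R})$. *)

(* Defs.v *)
From HB Require Import structures.
From mathcomp Require Import all_boot all_order all_algebra.
From mathcomp Require Import complex.
From mathcomp Require Import reals.
From mathcomp Require Import finmap.
From mathcomp Require Import monalg.
From mathcomp Require Import mpoly.

Set Implicit Arguments.
Unset Strict Implicit.
Unset Printing Implicit Defensive.

Import GRing.Theory.
Local Open Scope ring_scope.

(* A C[d]-module is an lmodType over {poly C}: the operator d is the action of
   'X, and C acts through the constant polynomials. *)

(* C[x_1, ..., x_n] (x) V, as finitely supported families of elements of V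
   indexed by the monomials in n indeterminates. *)
Notation vpoly n V := {malg V['X_{1..n}]}.

(* C[d][x_1, ..., x_n], which acts on C[x_1, ..., x_n] (x) V. *)
Notation dpoly n F := {mpoly {poly F}[n]}.

Section VPoly.
Variables (F : fieldType) (V : lmodType {poly F}).

Definition partial {n : nat} : dpoly n F := ('X)%:MP_[n].

Definition cst (n : nat) (a : V) : vpoly n V := << a *g 0%MM >>.

Definition tens (n : nat) (p : dpoly n F) (a : V) : vpoly n V :=
  \sum_(m <- mpoly.msupp p) << mpoly.mcoeff m p *: a *g m >>.

Definition vscale (n : nat) (p : dpoly n F) (f : vpoly n V) : vpoly n V :=
  \sum_(m <- monalg.msupp f) tens (p * 'X_[m]) (monalg.mcoeff m f).

(* f(p) for f in C[x] (x) V. The powers of p act on the coefficients of f, so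
   that for p = - x - d the operator d is applied to these coefficients. *)
Definition vsubst (n : nat) (p : dpoly n F) (f : vpoly 1 V) : vpoly n V :=
  \sum_(m <- monalg.msupp f) tens (p ^+ m ord0) (monalg.mcoeff m f).

(* For phi : a |-> phi_x(a) in C[x] (x) V, the C[x_1, ..., x_n]-linear
   extension of phi_p to C[x_1, ..., x_n] (x) V. *)
Definition ext1 (phi : V -> vpoly 1 V) (n : nat) (p : dpoly n F)
    (f : vpoly n V) : vpoly n V :=
  \sum_(m <- monalg.msupp f)
    vscale 'X_[m] (vsubst p (phi (monalg.mcoeff m f))).

(* For br : (a, b) |-> [a_x b] in C[x] (x) V, the C[x_1, ..., x_n]-bilinear
   extension of [a_p b] to C[x_1, ..., x_n] (x) V. *)
Definition ext2 (br : V -> V -> vpoly 1 V) (n : nat) (p : dpoly n F)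
    (f g : vpoly n V) : vpoly n V :=
  \sum_(m <- monalg.msupp f) \sum_(k <- monalg.msupp g)
    vscale ('X_[m] * 'X_[k])
      (vsubst p (br (monalg.mcoeff m f) (monalg.mcoeff k g))).

Definition Clinear (n : nat) (f : V -> vpoly n V) : Prop :=
  (forall a b : V, f (a + b) = f a + f b) /\
  (forall (c : F) (a : V), f (c%:P *: a) = vscale (c%:P)%:MP (f a)).

Record lie_conformal := LieConformal {
  lbr :> V -> V -> vpoly 1 V;
  lbr_linearl : forall b : V, Clinear (lbr^~ b);
  lbr_linearr : forall a : V, Clinear (lbr a);
  lbr_partiall : forall a b : V,
    let l : dpoly 1 F := 'X_0 in
    lbr ('X *: a) b = vscale (- l) (lbr a b);
  lbr_partialr : forall a b : V,
    let l : dpoly 1 F := 'X_0 in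
    lbr a ('X *: b) = vscale (partial + l) (lbr a b);
  lbr_skew : forall a b : V,
    let l : dpoly 1 F := 'X_0 in
    lbr a b = - vsubst (- l - partial) (lbr b a);
  lbr_jacobi : forall a b c : V,
    let l : dpoly 2 F := 'X_0 in
    let m : dpoly 2 F := 'X_1 in
    let a := cst 2 a in let b := cst 2 b in let c := cst 2 c in
    let br := @ext2 lbr 2 in
    br l a (br m b c) = br (l + m) (br l a b) c + br m b (br l a c)
}.

Record gc := GC {
  gc_fun :> V -> vpoly 1 V;
  gc_linear : Clinear gc_fun;
  gc_partial : forall a : V,
    let x : dpoly 1 F := 'X_0 in
    gc_fun ('X *: a) = vscale (partial + x) (gc_fun a)
}.

Definition finitely_generated : Prop :=
  exists s : seq V, forall a : V, exists c : nat -> {poly F},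
    a = \sum_(i < size s) c i *: s`_i.

Section LieConformal.
Variable L : lie_conformal.

Definition ideal (I : V -> Prop) : Prop :=
  [/\ I 0,
      forall (p : {poly F}) (a b : V), I a -> I b -> I (p *: a + b)
    & forall (a b : V) (m : 'X_{1..1}), I b ->
        I (monalg.mcoeff m (L a b)) /\ I (monalg.mcoeff m (L b a))].

Definition abelian : Prop := forall a b : V, L a b = 0.

Definition simple : Prop :=
  (forall I : V -> Prop, ideal I ->
     (forall a : V, I a -> a = 0) \/ (forall a : V, I a)) /\
  ~ abelian.

Definition CDer (phi : gc) : Prop :=
  forall a b : V,
    let x : dpoly 2 F := 'X_0 in
    let m : dpoly 2 F := 'X_1 in
    let a := cst 2 a in let b := cst 2 b in
    let br := @ext2 L 2 in
    let phi := @ext1 phi 2 in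
    phi x (br m a b) = br (m + x) (phi x a) b + br m a (phi x b).

Definition CTDer (phi : gc) : Prop :=
  forall a b c : V,
    let x : dpoly 3 F := 'X_0 in
    let l : dpoly 3 F := 'X_1 in
    let m : dpoly 3 F := 'X_2 in
    let a := cst 3 a in let b := cst 3 b in let c := cst 3 c in
    let br := @ext2 L 3 in
    let phi := @ext1 phi 3 in
    phi x (br (l + m) (br l a b) c) =
      br (l + m + x) (br (l + x) (phi x a) b) c +
      br (l + m + x) (br l a (phi x b)) c +
      br (l + m) (br l a b) (phi x c).

End LieConformal.

End VPoly.

(* Main.v *)
Require Import Defs.
From HB Require Import structures.
From mathcomp Require Import all_boot all_order all_algebra.
From mathcomp Require Import complex reals.
From mathcomp Require Import finmap monalg mpoly.
From mathcomp Require Import ring.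

Set Implicit Arguments.
Unset Strict Implicit.
Unset Printing Implicit Defensive.

Import GRing.Theory Num.Theory.
Local Open Scope ring_scope.

(* All formal variables are evaluated at scalars, so that the lambda-bracket
   becomes a family br l of C-bilinear operations on V indexed by l in C.

   Let E_{x,m}(a, b) = phi_x [a_m b] - [phi_x(a)_{m+x} b] - [a_m phi_x(b)] be the
   defect of phi as a derivation.  For a triple derivation, and suppressing the
   indices, E(ab, c) = - E(a, b) c, and by skew-symmetry E(c, ab) = - c E(a, b).
   With X = ab, the Jacobi identity for E(a, b), c, d gives
   - E(X, cd) = E(Xc, d) + E(c, Xd), while E applied to the Jacobi identity for
   X, c, d gives E(X, cd) = E(Xc, d) + E(c, Xd) because the centre is zero.
   Hence E(a, b) (cd) = - E(X, cd) = 0; as the algebra is perfect and has zero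
   centre, E(a, b) = 0. *)

(** Base-N digits are unique: the lowest is the remainder modulo N, and the quotient carries the
    others. *)
Lemma sum_base_inj (N n : nat) (f g : 'I_n -> nat) :
  (forall i, f i < N)%N -> (forall i, g i < N)%N ->
  (\sum_i f i * N ^ i = \sum_i g i * N ^ i)%N -> f =1 g.
Proof.
elim: n f g => [|n IHn] f g fN gN; first by move=> _ [].
have split_low h : (\sum_(i < n.+1) h i * N ^ i =
    (\sum_(i < n) h (lift ord0 i) * N ^ i) * N + h ord0)%N.
  rewrite big_ord_recl muln1 addnC; congr addn; rewrite big_distrl /=.
  by apply: eq_bigr => i _; rewrite /bump add1n expnSr mulnA.
rewrite !split_low => eq_fg.
have N_gt0 : (0 < N)%N := leq_ltn_trans (leq0n _) (fN ord0).
have eq0 : f ord0 = g ord0.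
  by move/(congr1 (modn^~ N)): eq_fg; rewrite !modnMDl !modn_small.
have /IHn eqS : (\sum_(i < n) f (lift ord0 i) * N ^ i =
    \sum_(i < n) g (lift ord0 i) * N ^ i)%N.
  move/(congr1 (divn^~ N)): eq_fg.
  by rewrite !divnMDl // !divn_small // !addn0.
by move=> i; case: (unliftP ord0 i) => [j|] -> //; apply: eqS.
Qed.

(** * Values of polynomials with coefficients in V *)

Section Evaluation.
Variables (F : fieldType) (V : lmodType {poly F}).
Implicit Types (p q r : {poly F}) (a b c v w : V).

(** Coordinates lie in C[d] and not only in C, because skew-symmetry evaluates the bracket at - l -
    d with d acting on its coefficients. *)
Definition ev n (t : 'I_n -> {poly F}) (f : vpoly n V) : V :=
  \sum_(m <- monalg.msupp f) mmap1 t m *: monalg.mcoeff m f.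

Definition const_pt n (s : 'I_n -> F) (i : 'I_n) : {poly F} := (s i)%:P.

Definition C_subspace (P : V -> Prop) : Prop :=
  P 0 /\ forall (x : F) a b, P a -> P b -> P (x%:P *: a + b).

Lemma C_subspace_sum (P : V -> Prop) (I : Type) (s : seq I) (x : I -> F)
    (v : I -> V) :
  C_subspace P -> (forall i, P (v i)) -> P (\sum_(i <- s) (x i)%:P *: v i).
Proof.
move=> [P0 PD] Pv; elim: s => [|i s IHs]; first by rewrite big_nil.
by rewrite big_cons; apply: PD.
Qed.

Hypothesis charF0 : [pchar F] =i pred0.

(** In characteristic 0 the points 0, ..., N - 1 are distinct, so their Vandermonde matrix is
    invertible and writes each coefficient as a C-combination of values. *)
Lemma coef_of_values (P : V -> Prop) (N : nat) (v : 'I_N -> V) :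
  C_subspace P ->
  (forall x : F, P (\sum_(k < N) (x ^+ k)%:P *: v k)) -> forall k, P (v k).
Proof.
move=> subP Pv k; pose a : 'rV[F]_N := \row_j j%:R.
have unitW : Vandermonde N a \in unitmx.
  rewrite unitmxE det_Vandermonde unitfE; apply/prodf_neq0 => i _.
  apply/prodf_neq0 => j lt_ij; rewrite !mxE -natrB ?(ltnW lt_ij) //.
  by move/pcharf0P: charF0 => ->; rewrite subn_eq0 -ltnNge.
have -> : v k = \sum_j (invmx (Vandermonde N a) j k)%:P *:
    (\sum_(i < N) (a 0 j ^+ i)%:P *: v i).
  have VW (i : 'I_N) : \sum_j a 0 j ^+ i * invmx (Vandermonde N a) j k = (i == k)%:R.
    have /matrixP/(_ i k) := mulmxV unitW.
    by rewrite [LHS]mxE [RHS]mxE => <-; apply: eq_bigr => j _; rewrite [in RHS]mxE.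
  have VWv (i : 'I_N) : \sum_j (invmx (Vandermonde N a) j k)%:P *: ((a 0 j ^+ i)%:P *: v i)
      = ((i == k)%:R)%:P *: v i.
    rewrite -VW rmorph_sum scaler_suml; apply: eq_bigr => j _.
    by rewrite scalerA -polyCM mulrC.
  under eq_bigr do rewrite scaler_sumr.
  rewrite exchange_big /= (bigD1 k) //= VWv eqxx scale1r big1 ?addr0 // => i.
  by rewrite VWv => /negPf->; rewrite scale0r.
exact: C_subspace_sum.
Qed.

(* Kronecker substitution x_i := y ^ (N ^ i) with N larger than all exponents
   keeps distinct monomials of f distinct, which leaves one variable. *)
Lemma mcoeff_of_ev (P : V -> Prop) n (f : vpoly n V) :
  C_subspace P -> (forall s : 'I_n -> F, P (ev (const_pt s) f)) ->
  forall m, P (monalg.mcoeff m f).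
Proof.
move=> subP Pf m0.
case: (boolP (m0 \in monalg.msupp f)) => [m0f|/mcoeff_outdom->]; last first.
  by case: subP.
pose N := (\max_(m <- monalg.msupp f) mdeg m).+1.
pose wt (m : 'X_{1..n}) := (\sum_(i < n) m i * N ^ i)%N.
pose K := (\max_(m <- monalg.msupp f) wt m).+1.
have mN m i : m \in monalg.msupp f -> (m i < N)%N.
  move=> mf; rewrite ltnS (leq_trans _ (leq_bigmax_seq _ mf isT)) //.
  by rewrite mdegE (bigD1 i) //= leq_addr.
have wtK m : m \in monalg.msupp f -> (wt m < K)%N.
  by move=> mf; rewrite ltnS (leq_bigmax_seq _ mf isT).
(* [v k] is the coefficient of y ^ k after the substitution. At most one monomial of the support has
   weight k, so no two coefficients of f get mixed. *)
pose v (k : 'I_K) :=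
  \sum_(m <- monalg.msupp f | wt m == k) monalg.mcoeff m f.
have Pv : forall k, P (v k).
  apply: coef_of_values => // x; have := Pf (fun i => x ^+ (N ^ i)%N).
  rewrite /ev /v; under [X in _ -> P X]eq_bigr do
    rewrite scaler_sumr big_mkcond /=.
  rewrite exchange_big /=; congr (P _).
  rewrite big_seq [RHS]big_seq; apply: eq_bigr => m mf.
  rewrite -big_mkcond /= (bigD1 (Ordinal (wtK m mf))) //= big1 ?addr0.
    congr (_ *: _); rewrite /mmap1 /const_pt /wt expr_sum rmorph_prod /=.
    by apply: eq_bigr => i _; rewrite -rmorphXn -exprM mulnC.
  by move=> k /andP[/eqP eq_k /eqP[]]; apply: val_inj.
have := Pv (Ordinal (wtK m0 m0f)); congr (P _).
rewrite /v big_mkcond (bigD1_seq m0) ?fset_uniq //= eqxx big1_seq ?addr0 // => m.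
case/andP=> neq_m mf; case: eqP => // eq_wt; case/eqP: neq_m; apply/mnmP.
by apply: sum_base_inj eq_wt => i; apply: mN.
Qed.

Lemma evD n t : {morph @ev n t : f g / f + g}.
Proof.
move=> f g; pose d := (monalg.msupp f `|` monalg.msupp g)%fset.
(* The supports of f, g and f + g differ, so all three sums are extended by zero terms to a common
   index set. *)
have evw h : (monalg.msupp h `<=` d)%fset ->
    ev t h = \sum_(m <- d) mmap1 t m *: monalg.mcoeff m h.
  move=> /fsubsetP hd; rewrite /ev; apply/esym; rewrite (bigID (mem (monalg.msupp h))) /=.
  rewrite [X in _ + X]big1 ?addr0 => [|m /mcoeff_outdom->]; last by rewrite scaler0.
  rewrite -big_filter; apply: perm_big; apply: uniq_perm => [||m].
  - exact/filter_uniq/fset_uniq.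
  - exact: fset_uniq.
  - by rewrite mem_filter; case: (boolP (m \in monalg.msupp h)) => // /hd ->.
rewrite !evw ?fsubsetUl ?fsubsetUr ?monalg.msuppD_le // -big_split /=.
by apply: eq_bigr => m _; rewrite monalg.mcoeffD scalerDr.
Qed.

Lemma ev0 n t : @ev n t 0 = 0.
Proof. by rewrite /ev monalg.msupp0 big_nil. Qed.

HB.instance Definition _ n t :=
  GRing.isNmodMorphism.Build (vpoly n V) V (@ev n t) (conj (ev0 t) (@evD n t)).

Lemma evU n t (m : 'X_{1..n}) a : ev t << a *g m >> = mmap1 t m *: a.
Proof.
rewrite /ev msuppU; case: eqP => [->|_]; first by rewrite big_nil scaler0.
by rewrite big_seq_fset1 mcoeffUU.
Qed.

Lemma ev_ext n (t t' : 'I_n -> {poly F}) f : t =1 t' -> ev t f = ev t' f.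
Proof. by move=> eq_t; apply: eq_bigr => m _; rewrite (mmap1_eq _ eq_t). Qed.

Lemma ev_cst n t a : @ev n t (cst n a) = a.
Proof. by rewrite evU mmap11 scale1r. Qed.

Lemma ev_tens n t (p : dpoly n F) a : ev t (tens p a) = p.@[t] *: a.
Proof.
rewrite raddf_sum /= /meval /mmap scaler_suml; apply: eq_bigr => m _.
by rewrite evU scalerA mulrC.
Qed.

Lemma ev_vscale n t (p : dpoly n F) (f : vpoly n V) :
  ev t (vscale p f) = p.@[t] *: ev t f.
Proof.
rewrite raddf_sum scaler_sumr; apply: eq_bigr => m _ /=.
by rewrite ev_tens mevalM scalerA mevalX.
Qed.

Definition ev1 (q : {poly F}) (f : vpoly 1 V) : V := ev (fun=> q) f.

Lemma ev_vsubst n t (p : dpoly n F) (f : vpoly 1 V) :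
  ev t (vsubst p f) = ev1 p.@[t] f.
Proof.
rewrite raddf_sum; apply: eq_bigr => m _ /=.
by rewrite ev_tens rmorphXn /mmap1 big_ord1.
Qed.

Lemma eq_ev n (f g : vpoly n V) :
  (forall s : 'I_n -> F, ev (const_pt s) f = ev (const_pt s) g) -> f = g.
Proof.
move=> eq_fg; apply/subr0_eq/malgP => m; rewrite monalg.mcoeff0.
apply: (@mcoeff_of_ev (fun v => v = 0)) => [|s].
  by split=> // x a b -> ->; rewrite scaler0 addr0.
by rewrite raddfB /= eq_fg subrr.
Qed.

(** * Semilinear maps over C[d] *)

(* h is C-linear and intertwines 'X with r, as x |-> [a_q x] does for
   r = 'X + q and x |-> [x_q b] for r = - q. *)
Definition semilin (r : {poly F}) (h : V -> V) : Prop :=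
  forall p a b, h (p *: a + b) = (p \Po r) *: h a + h b.

Lemma semilinD r h : semilin r h -> {morph h : a b / a + b}.
Proof. by move=> hl a b; rewrite -[a in LHS]scale1r hl comp_polyC scale1r. Qed.

Lemma semilin0 r h : semilin r h -> h 0 = 0.
Proof. by move=> hl; apply: (addrI (h 0)); rewrite -(semilinD hl) !addr0. Qed.

Lemma semilinZ r h p a : semilin r h -> h (p *: a) = (p \Po r) *: h a.
Proof. by move=> hl; rewrite -[p *: a]addr0 hl (semilin0 hl) addr0. Qed.

Lemma semilinN r h : semilin r h -> {morph h : a / - a}.
Proof.
by move=> hl a; rewrite -scaleN1r (semilinZ _ _ hl) -polyCN comp_polyC polyCN scaleN1r.
Qed.

Lemma semilin_comp r r' h h' : semilin r h -> semilin r' h' ->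
  semilin (r \Po r') (h' \o h).
Proof. by move=> hl hl' p a b /=; rewrite hl hl' comp_polyA. Qed.

Lemma semilin_ev r h n (t : 'I_n -> {poly F}) f : semilin r h ->
  h (ev t f) =
    \sum_(m <- monalg.msupp f) mmap1 (fun i => t i \Po r) m *: h (monalg.mcoeff m f).
Proof.
move=> hl; rewrite /ev (big_morph h (semilinD hl) (semilin0 hl)).
by apply: eq_bigr => m _; rewrite (semilinZ _ _ hl) /mmap1 rmorph_prod;
  under eq_bigr do rewrite rmorphXn.
Qed.

(** Once h is applied, only the image of the index under d := r matters. For constant r, this turns
    an index containing d into a scalar. *)
Lemma semilin_ev1 r h q q' f : semilin r h -> q \Po r = q' \Po r ->
  h (ev1 q f) = h (ev1 q' f).
Proof. by move=> hl eqq; rewrite /ev1 !(semilin_ev _ _ hl) eqq. Qed.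

Lemma Clinear_ev1 (f : V -> vpoly 1 V) q r : Clinear f ->
  (forall a, ev1 q (f ('X *: a)) = r *: ev1 q (f a)) ->
  semilin r (fun a => ev1 q (f a)).
Proof.
move=> [fD fZ] fX.
have f0 : f 0 = 0 by apply: (addrI (f 0)); rewrite -fD !addr0.
have hD a b : ev1 q (f (a + b)) = ev1 q (f a) + ev1 q (f b) by rewrite fD /ev1 raddfD.
have hC (x : F) a : ev1 q (f (x%:P *: a)) = x%:P *: ev1 q (f a).
  by rewrite fZ /ev1 ev_vscale mevalC.
move=> p a b; rewrite hD; congr (_ + _).
elim/poly_ind: p a => [|p c IHp] a.
  by rewrite comp_poly0 !scale0r f0 /ev1 raddf0.
rewrite scalerDl hD hC -scalerA IHp fX scalerA -scalerDl.
by rewrite comp_polyD comp_polyM comp_polyX comp_polyC.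
Qed.

(** * The bracket and phi as operations indexed by scalars *)

Section ConformalMaps.
Variables (L : lie_conformal V) (phi : gc V).

Definition B q a b := ev1 q (L a b).
Definition Phi q a := ev1 q (phi a).

Lemma B_semilinl q b : semilin (- q) (B q ^~ b).
Proof.
apply: Clinear_ev1 (lbr_linearl L b) _ => a.
by rewrite lbr_partiall /ev1 ev_vscale mevalN mevalXU.
Qed.

Lemma B_semilinr q a : semilin ('X + q) (B q a).
Proof.
apply: Clinear_ev1 (lbr_linearr L a) _ => b.
by rewrite lbr_partialr /ev1 ev_vscale mevalD mevalC mevalXU.
Qed.

Lemma Phi_semilin q : semilin ('X + q) (Phi q).
Proof.
apply: Clinear_ev1 (gc_linear phi) _ => a.
by rewrite gc_partial /ev1 ev_vscale mevalD mevalC mevalXU.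
Qed.

Lemma B_skew q a b : B q a b = - B (- q - 'X) b a.
Proof.
by rewrite /B lbr_skew /ev1 raddfN /= ev_vsubst mevalD !mevalN mevalC mevalXU.
Qed.

(** [Phi q] substitutes d + q for d in scalars pulled out of it, which fixes the constant
    coordinates of the point; hence evaluation commutes with the extension. *)
Lemma ev_ext1 n (s : 'I_n -> F) (p : dpoly n F) f q a :
  p.@[const_pt s] = q -> ev (const_pt s) f = a ->
  ev (const_pt s) (ext1 phi p f) = Phi q a.
Proof.
move=> <- <-.
rewrite (semilin_ev _ _ (Phi_semilin _)) raddf_sum; apply: eq_bigr => m _ /=.
rewrite ev_vscale ev_vsubst mevalX; congr (_ *: _).
by apply: eq_bigr => i _; rewrite /const_pt comp_polyC.
Qed.

Lemma ev_ext2 n (s : 'I_n -> F) (p : dpoly n F) f g q a b :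
  p.@[const_pt s] = q -> ev (const_pt s) f = a -> ev (const_pt s) g = b ->
  ev (const_pt s) (ext2 L p f g) = B q a b.
Proof.
move=> <- <- <-.
rewrite (semilin_ev _ _ (B_semilinl _ _)) raddf_sum; apply: eq_bigr => m _ /=.
rewrite (semilin_ev _ _ (B_semilinr _ _)) raddf_sum scaler_sumr.
apply: eq_bigr => k _ /=.
rewrite ev_vscale ev_vsubst mevalM !mevalX scalerA; congr (_ * _ *: _).
  by apply: eq_bigr => i _; rewrite /const_pt comp_polyC.
by apply: eq_bigr => i _; rewrite /const_pt comp_polyC.
Qed.

Lemma ev_add n (t : 'I_n -> {poly F}) f g a b :
  ev t f = a -> ev t g = b -> ev t (f + g) = a + b.
Proof. by move=> <- <-; apply: evD. Qed.

Lemma meval_add n (s : 'I_n -> F) (p q : dpoly n F) (x y : F) :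
  p.@[const_pt s] = x%:P -> q.@[const_pt s] = y%:P ->
  (p + q).@[const_pt s] = (x + y)%:P.
Proof. by rewrite mevalD polyCD => -> ->. Qed.

(* Goal-directed, because a rewrite would compare distinct polynomial
   indeterminates up to conversion, which does not terminate in practice. *)
Ltac eval_at_scalars := repeat match goal with
  | |- ev _ (ext2 _ _ _ _) = _ => refine (ev_ext2 _ _ _)
  | |- ev _ (ext1 _ _ _) = _ => refine (ev_ext1 _ _)
  | |- ev _ (cst _ _) = _ => exact: ev_cst
  | |- ev _ (_ + _) = _ => refine (ev_add _ _)
  | |- meval _ (_ + _) = _ => refine (meval_add _ _)
  | |- meval _ _ = _ => exact: mevalXU
  end.

Local Notation br l := (B l%:P).
Local Notation ph x := (Phi x%:P).

Lemma br_jacobi (l m : F) a b c :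
  br l a (br m b c) = br (l + m) (br l a b) c + br m b (br l a c).
Proof.
pose s (i : 'I_2) := [:: l; m]`_i.
have J := congr1 (ev (const_pt s)) (lbr_jacobi L a b c).
apply: (etrans (esym _) (etrans J _)); rewrite -/(s 0) -/(s 1); eval_at_scalars.
Qed.

(** Skew-symmetry gives the index - m - d, and d acts as - n inside the left slot of the outer
    bracket. *)
Lemma br_skew_l (m n : F) a b c :
  br n (br m a b) c = - br n (br (n - m) b a) c.
Proof.
rewrite (B_skew m%:P) (semilinN (B_semilinl _ _)); congr (- _).
apply: (semilin_ev1 _ (B_semilinl _ _)).
rewrite -!polyCN comp_polyB comp_polyX !comp_polyC -polyCB; congr polyC; ring.
Qed.

(** Here d first becomes d + x on passing through phi_x, then x - n in the outer bracket, so - m - d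
    becomes n - m - x. *)
Lemma br_ph_skew_l (x m n : F) a b c :
  br n (ph x (br m a b)) c = - br n (ph x (br (n - m - x) b a)) c.
Proof.
have hl := semilin_comp (Phi_semilin x%:P) (B_semilinl n%:P c).
rewrite (B_skew m%:P) (semilinN (Phi_semilin _)) (semilinN (B_semilinl _ _)).
congr (- _); apply: (semilin_ev1 _ hl).
rewrite -!polyCN comp_polyB comp_polyD !comp_polyX !comp_polyC -polyCD -polyCB.
congr polyC; ring.
Qed.

(** * The defect of phi as a derivation *)

Definition derdef (x m : F) a b :=
  ph x (br m a b) - br (m + x) (ph x a) b - br m a (ph x b).

Lemma derdefDl x m a1 a2 b :
  derdef x m (a1 + a2) b = derdef x m a1 b + derdef x m a2 b.
Proof.
rewrite /derdef (semilinD (Phi_semilin x%:P)) !(semilinD (B_semilinl _ _)).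
by rewrite (semilinD (Phi_semilin _)) !opprD (addrACA (ph x _)) [LHS]addrACA.
Qed.

(** Skew-symmetry of the defect is stated under an outer bracket, where its index is again a
    scalar. *)
Lemma derdef_skew_l x m n a b c :
  br n (derdef x m a b) c = - br n (derdef x (n - m - x) b a) c.
Proof.
rewrite /derdef !(semilinD (B_semilinl _ _)) !(semilinN (B_semilinl _ _)).
rewrite br_ph_skew_l (br_skew_l (m + x)) (br_skew_l m).
have -> : n - (m + x) = n - m - x by ring.
have -> : n - m - x + x = n - m by ring.
by rewrite !opprD !opprK addrAC.
Qed.

Lemma CDerP : CDer L phi <-> forall x m a b, derdef x m a b = 0.
Proof.
have evl (s : 'I_2 -> F) a b :
  ev (const_pt s) (ext1 phi ('X_0) (ext2 L ('X_1) (cst 2 a) (cst 2 b))) =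
  ph (s 0) (br (s 1) a b) by eval_at_scalars.
have evr (s : 'I_2 -> F) a b :
  ev (const_pt s) (ext2 L ('X_1 + 'X_0) (ext1 phi 'X_0 (cst 2 a)) (cst 2 b) +
     ext2 L 'X_1 (cst 2 a) (ext1 phi 'X_0 (cst 2 b))) =
  br (s 1 + s 0) (ph (s 0) a) b + br (s 1) a (ph (s 0) b) by eval_at_scalars.
split=> [der x m a b|der a b]; last first.
  cbv zeta; apply: eq_ev => s; apply: (etrans (evl s a b)).
  apply: etrans (esym (evr s a b)); apply/eqP; rewrite -subr_eq0 opprD addrA.
  exact/eqP/der.
pose s (i : 'I_2) := [:: x; m]`_i.
have := etrans (esym (evl s a b)) (etrans (congr1 (ev (const_pt s)) (der a b)) (evr s a b)).
by move=> /eqP; rewrite -subr_eq0 opprD addrA => /eqP.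
Qed.

(** When both defects are expanded, the terms with phi_x applied to [a_l b] inside a bracket with c
    cancel, and the triple derivation identity remains. *)
Lemma CTDerP : CTDer L phi <-> forall x l m a b c,
  derdef x (l + m) (br l a b) c = - br (l + m + x) (derdef x l a b) c.
Proof.
have evl (s : 'I_3 -> F) a b c :
  ev (const_pt s) (ext1 phi ('X_0)
    (ext2 L ('X_1 + 'X_2) (ext2 L 'X_1 (cst 3 a) (cst 3 b)) (cst 3 c))) =
  ph (s 0) (br (s 1 + s 2) (br (s 1) a b) c) by eval_at_scalars.
have evr (s : 'I_3 -> F) a b c :
  ev (const_pt s) (ext2 L ('X_1 + 'X_2 + 'X_0)
      (ext2 L ('X_1 + 'X_0) (ext1 phi 'X_0 (cst 3 a)) (cst 3 b)) (cst 3 c) +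
    ext2 L ('X_1 + 'X_2 + 'X_0)
      (ext2 L 'X_1 (cst 3 a) (ext1 phi 'X_0 (cst 3 b))) (cst 3 c) +
    ext2 L ('X_1 + 'X_2) (ext2 L 'X_1 (cst 3 a) (cst 3 b)) (ext1 phi 'X_0 (cst 3 c)))
  = br (s 1 + s 2 + s 0) (br (s 1 + s 0) (ph (s 0) a) b) c +
    br (s 1 + s 2 + s 0) (br (s 1) a (ph (s 0) b)) c +
    br (s 1 + s 2) (br (s 1) a b) (ph (s 0) c) by eval_at_scalars.
have eqE x l m a b c :
  derdef x (l + m) (br l a b) c + br (l + m + x) (derdef x l a b) c =
  ph x (br (l + m) (br l a b) c) -
  (br (l + m + x) (br (l + x) (ph x a) b) c +
   br (l + m + x) (br l a (ph x b)) c + br (l + m) (br l a b) (ph x c)).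
  rewrite /derdef !(semilinD (B_semilinl _ c)) !(semilinN (B_semilinl _ c)).
  set P := br _ (ph x (br l a b)) c; rewrite [LHS]addrAC -[P + _ - _]addrA addrA.
  by rewrite subrK !opprD !addrA.
split=> [der x l m a b c|der a b c]; last first.
  cbv zeta; apply: eq_ev => s; apply: (etrans (evl s a b c)).
  apply: etrans (esym (evr s a b c)); apply/eqP; rewrite -subr_eq0 -eqE.
  by rewrite der addNr.
pose s (i : 'I_3) := [:: x; l; m]`_i.
have := etrans (esym (evl s a b c))
  (etrans (congr1 (ev (const_pt s)) (der a b c)) (evr s a b c)).
by move=> /eqP; rewrite -subr_eq0 -eqE addr_eq0 => /eqP.
Qed.

Lemma CDer_CTDer : CDer L phi -> CTDer L phi.
Proof.
move/CDerP=> der; apply/CTDerP => x l m a b c.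
by rewrite !der (semilin0 (B_semilinl _ _)) oppr0.
Qed.

(** * Centre and derived algebra of a simple algebra *)

Section Simple.
Hypothesis simpleL : simple L.

Lemma ev_lbr (s : 'I_1 -> F) a b : ev (const_pt s) (L a b) = br (s ord0) a b.
Proof. by apply: ev_ext => i; rewrite ord1. Qed.

Lemma lbr_eq0 a b : (forall l, br l a b = 0) -> L a b = 0.
Proof. by move=> br0; apply: eq_ev => s; rewrite ev_lbr br0 ev0. Qed.

(** The centre is an ideal; were it everything, the algebra would be abelian. *)
Lemma centerless a : (forall l b, br l a b = 0) -> a = 0.
Proof.
case: simpleL => simpleI nonab; pose Z a := forall l b, br l a b = 0.
have L0 u b : Z u -> L u b = 0 by move=> Zu; apply: lbr_eq0.
have idZ : ideal L Z.
  split=> [l b|p u v Zu Zv l b|u v m Zv]; first exact: (semilin0 (B_semilinl _ b)).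
    by rewrite (B_semilinl _ b) Zu Zv scaler0 addr0.
  rewrite lbr_skew !L0 // /vsubst monalg.msupp0 big_nil oppr0 monalg.mcoeff0.
  by split=> l b; apply: (semilin0 (B_semilinl _ b)).
case: (simpleI _ idZ) => [Z0|Zall]; first exact: Z0.
by case: nonab => u v; apply: L0.
Qed.

Lemma perfect (P : V -> Prop) :
  P 0 -> (forall p a b, P a -> P b -> P (p *: a + b)) ->
  (forall a b m, P (monalg.mcoeff m (L a b))) -> forall v, P v.
Proof.
move=> P0 PD PL; case: simpleL => simpleI nonab.
(* The derived algebra, as the intersection of all C[d]-submodules containing the coefficients of
   brackets. It is an ideal, and nonzero because the bracket is. *)
pose D v := forall Q : V -> Prop,
  Q 0 -> (forall p a b, Q a -> Q b -> Q (p *: a + b)) ->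
  (forall a b m, Q (monalg.mcoeff m (L a b))) -> Q v.
have idD : ideal L D.
  split=> [Q //|p a b Da Db Q Q0 QD QL|a b m _]; last by split=> Q _ _; apply.
  exact: QD (Da Q Q0 QD QL) (Db Q Q0 QD QL).
case: (simpleI _ idD) => [D0|Dall v]; last exact: Dall.
case: nonab => a b; apply/malgP => m; rewrite monalg.mcoeff0.
by apply: D0 => Q _ _; apply.
Qed.

(** The kernel of [a_l -] is a submodule. It contains the values of all brackets, hence their
    coefficients, hence V by perfectness; so a is central. *)
Lemma centralizer_derived a :
  (forall l m b c, br l a (br m b c) = 0) -> a = 0.
Proof.
move=> cent; apply: centerless => l; apply: (@perfect (fun v => br l a v = 0)) => [|p b c b0 c0|b c].
- exact: (semilin0 (B_semilinr _ _)).
- by rewrite (B_semilinr _ a) b0 c0 scaler0 addr0.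
apply: (@mcoeff_of_ev (fun v => br l a v = 0)) => [|s]; last by rewrite ev_lbr cent.
split=> [|x u v u0 v0]; first exact: (semilin0 (B_semilinr _ _)).
by rewrite (B_semilinr _ a) u0 v0 scaler0 addr0.
Qed.

(** * Vanishing of the defect of a triple derivation *)

Section TripleDerivation.
Hypothesis tder : CTDer L phi.

Lemma derdef_brl x l m a b c :
  derdef x m (br l a b) c = - br (m + x) (derdef x l a b) c.
Proof. by move/CTDerP: tder => /(_ x l (m - l) a b c); rewrite addrC subrK. Qed.

(** This mirrors [derdef_brl] by skew-symmetry. Since that holds for defects under an outer bracket,
    both sides are bracketed with an arbitrary w and the zero centre removes w. *)
Lemma derdef_brr x l m a b c :
  derdef x m c (br l a b) = - br m c (derdef x l a b).
Proof.
apply/eqP; rewrite -addr_eq0; apply/eqP; apply: centerless => n w.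
rewrite (semilinD (B_semilinl _ w)) derdef_skew_l derdef_brl subrK.
by rewrite (semilinN (B_semilinl _ w)) opprK (br_skew_l m) subrr.
Qed.

Lemma br_derdefl x k l a b c :
  br k (derdef x l a b) c = - derdef x (k - x) (br l a b) c.
Proof. by rewrite derdef_brl subrK opprK. Qed.

Lemma derdef_br_br x l m n a b c d :
  derdef x m (br l a b) (br n c d) = 0.
Proof.
set X := br l a b.
pose S := derdef x (m + n) (br m X c) d + derdef x n c (br m X d).
(* This is the Jacobi identity for E(a, b), c, d with indices m + x and n: each defect of a bracket
   is rewritten as a bracket with E(a, b). *)
have eqN : - derdef x m X (br n c d) = S.
  rewrite /S (derdef_brl x m) (derdef_brr x m n X d c) !(derdef_brl x l).
  rewrite (semilinN (B_semilinl _ d)) (semilinN (B_semilinr _ c)) !opprK.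
  by rewrite br_jacobi addrAC.
(* Bracketing with w turns each defect E(u, v) into - E(uv, w). By additivity in the first argument,
   the claim becomes the Jacobi identity for X, c, d inside E(-, w). *)
have eqS : derdef x m X (br n c d) = S.
  apply/eqP; rewrite -subr_eq0; apply/eqP; apply: centerless => k w.
  rewrite (semilinD (B_semilinl _ w)) (semilinN (B_semilinl _ w)).
  rewrite (br_derdefl x) /S (semilinD (B_semilinl _ w)) !(br_derdefl x).
  by rewrite -(opprD (derdef x _ (br (m + n) _ _) w)) -derdefDl -br_jacobi subrr.
have two_neq0 : 2 != 0 :> F by move/pcharf0P: charF0 => ->.
have eq0 : derdef x m X (br n c d) + derdef x m X (br n c d) = 0.
  by rewrite {1}eqS -eqN addNr.
(* The defect equals both S and - S, so it vanishes after division by 2. *)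
rewrite -[LHS]scale1r -[1](_ : (2^-1)%:P * 2%:P = 1); last first.
  by rewrite -polyCM mulVf.
by rewrite -scalerA polyCD scalerDl scale1r eq0 scaler0.
Qed.

Lemma CTDer_CDer : CDer L phi.
Proof.
apply/CDerP => x m a b; apply: centralizer_derived => k n c d.
by rewrite br_derdefl derdef_br_br oppr0.
Qed.

End TripleDerivation.
End Simple.
End ConformalMaps.
End Evaluation.

Theorem theorem4p4 (R : realType) (V : lmodType {poly R[i]})
    (L : lie_conformal V) (hfin : finitely_generated V) (hsimple : simple L)
    (phi : gc V) :
  CTDer L phi <-> CDer L phi.
Proof.
have charC : [pchar R[i]] =i pred0 by exact: pchar_num.
split; first exact: (CTDer_CDer charC hsimple).
exact: (CDer_CTDer charC).
Qed.
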